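(* Let $r\ge 2$ and $a_1,\ldots,a_r$ be integers with $a_i\ge 2$ for all $i$, and let $G$ be the cograph with balanced cotree $T_G(a_1,\ldots,a_{r-1},0\,|\,0,\ldots,0,a_r)$, of order $n=a_1a_2\cdots a_r$. For $1\le i\le r-1$ define $$x_r^{i}=\begin{cases}\displaystyle\sum_{k=1}^{r-i}\gamma_{r,i+k}(-1)^{k}+\varepsilon_r & \text{if } i \text{ is even},\\[2mm] \displaystyle\sum_{k=1}^{r-i}\gamma_{r,i+k}(-1)^{k+1}+\varepsilon_r & \text{if } i \text{ is odd},\end{cases}$$ where $\varepsilon_r=1$ if $r$ is odd and $\varepsilon_r=0$ if $r$ is even. Then for every $1\le i\le r-1$, $-x_r^{i}$ is an eigenvalue of the adjacency matrix of $G$ with multiplicity $$m(-x_r^{i},G)=a_1a_2\cdots a_{i-1}(a_i-1)$$ (for $i=1$ this reads $a_1-1$).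
   Context: A cograph is a graph built from single vertices by disjoint unions and joins; it is represented by a rooted cotree whose leaves are the vertices of the graph and whose internal nodes are labelled $\otimes$ (join) or $\cup$ (union); two vertices are adjacent iff their lowest common ancestor in the cotree is a $\otimes$ node. The balanced cotree $T_G(a_1,\ldots,a_{r-1},0\,|\,0,\ldots,0,a_r)$ of depth $r$ is the rooted tree in which the root (level $0$) is a $\otimes$ node, every internal node at level $\ell$ ($0\le \ell\le r-1$) is labelled $\otimes$ if $\ell$ is even and $\cup$ if $\ell$ is odd, each internal node at level $\ell$ with $0\le \ell\le r-2$ has exactly $a_{\ell+1}$ children, all internal, and each node at level $r-1$ has exactly $a_r$ children, which are leaves; so all $a_1\cdots a_r$ leaves lie at level $r$. For $l\le n$, $\gamma_{n,l}=a_na_{n-1}\cdots a_l$ (so $\gamma_{n,n}=a_n$). $m(\lambda,G)$ denotes the multiplicity of $\lambda$ as an eigenvalue of the adjacency matrix of $G$. *)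

(* Defs.v *)
From HB Require Import structures.
From mathcomp Require Import all_boot all_order all_algebra.
From mathcomp Require Import reals.

Set Implicit Arguments.
Unset Strict Implicit.
Unset Printing Implicit Defensive.

Import GRing.Theory.

Inductive colabel := Join | Union.

Inductive cotree :=
| Leaf
| Node (lab : colabel) (k : nat) (child : 'I_k -> cotree).

(* The leaves of a cotree: a leaf below an internal node is a child index
   together with a leaf of that child. *)
Fixpoint leaves (t : cotree) : finType :=
  match t with
  | Leaf => unit
  | Node _ k child => {i : 'I_k & leaves (child i)}
  end.

(* The subtree rooted at the lowest common ancestor of two leaves; it is [Leaf]
   exactly when the two leaves coincide. *)
Fixpoint lca (t : cotree) : leaves t -> leaves t -> cotree :=
  match t return leaves t -> leaves t -> cotree with
  | Leaf => fun _ _ => Leaf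
  | Node lab k child => fun u v =>
      if tag u == tag v then lca (tagged u) (tagged_as u v)
      else Node lab child
  end.

Definition cograph_adj (t : cotree) : rel (leaves t) :=
  fun u v => if lca u v is Node Join _ _ then true else false.

Lemma lcaC (t : cotree) (u v : leaves t) : lca u v = lca v u.
Proof.
elim: t u v => [|lab k child IH] //= [i p] [j q] /=.
case: (eqVneq i j) => [eij|//].
by move: p q; case: j / eij => p q; rewrite !tagged_asE IH.
Qed.

Lemma cograph_adj_sym (t : cotree) : symmetric (@cograph_adj t).
Proof. by move=> u v; rewrite /cograph_adj lcaC. Qed.

Lemma lca_refl (t : cotree) (u : leaves t) : lca u u = Leaf.
Proof. by elim: t u => [|lab k child IH] //= [i p] /=; rewrite eqxx tagged_asE. Qed.

Lemma cograph_adj_irrefl (t : cotree) : irreflexive (@cograph_adj t).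
Proof. by move=> u; rewrite /cograph_adj lca_refl. Qed.

Definition level_label (l : nat) : colabel := if odd l then Union else Join.

(* The part of the balanced cotree below a node at level [l], when [d] levels
   remain; the sequence [a] is indexed from 1, and [a 0] is never used. *)
Fixpoint balanced_below (a : nat -> nat) (l d : nat) : cotree :=
  match d with
  | 0 => Leaf
  | d'.+1 =>
      Node (level_label l) (fun _ : 'I_(a l.+1) => balanced_below a l.+1 d')
  end.

Definition balanced_cotree (a : nat -> nat) (r : nat) : cotree :=
  balanced_below a 0 r.

Definition gamma (a : nat -> nat) (n l : nat) : nat :=
  (\prod_(l <= j < n.+1) a j)%N.

Lemma card_balanced_below (a : nat -> nat) (l d : nat) :
  #|leaves (balanced_below a l d)| = gamma a (l + d) l.+1.
Proof.
rewrite /gamma.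
elim: d l => [|d IH] l /=; first by rewrite card_unit addn0 big_geq.
rewrite card_tagged sumnE big_map big_enum /=.
rewrite (eq_bigr (fun=> \prod_(l.+2 <= j < (l.+1 + d).+1) a j)); last first.
  by move=> i _; rewrite IH.
rewrite sum_nat_const card_ord.
by rewrite [RHS]big_ltn ?addnS ?addSn // !ltnS leq_addr.
Qed.

Lemma card_balanced_cotree (a : nat -> nat) (r : nat) :
  #|leaves (balanced_cotree a r)| = gamma a r 1.
Proof. exact: card_balanced_below. Qed.

Local Open Scope ring_scope.

Definition adjacency_mx (R : realType) (T : finType) (e : rel T) : 'M[R]_#|T| :=
  \matrix_(i, j) (e (enum_val i) (enum_val j))%:R.

Definition eigen_mult (R : realType) (n : nat) (lambda : R) (A : 'M[R]_n) : nat :=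
  mup lambda (char_poly A).

Definition eps (r : nat) : int := if odd r then 1 else 0.

Definition xval (a : nat -> nat) (r i : nat) : int :=
  if odd i
  then (\sum_(1 <= k < (r - i).+1) (gamma a r (i + k))%:Z * (-1) ^+ k.+1) + eps r
  else (\sum_(1 <= k < (r - i).+1) (gamma a r (i + k))%:Z * (-1) ^+ k) + eps r.

(* Main.v *)
(** Below a node at level [l] the graph is regular, of degree [D] and order [n]
    say, and a node with [k] children joins (c = 1) or leaves disjoint (c = 0)
    [k] copies of the graph below a child.  If [M] has constant row sums [s]
    and [J] is the all-ones matrix of order [n], then
    [det (M + t J) s = det M (s + t n)].  Applied once to each copy and once to
    the whole block matrix, this turns a characteristic polynomial [(X - D) Q]
    into [(X - D') Q^k (X - (D - c n))^(k - 1)], where [D'] is the new degree.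
    By induction the spectrum is [D_0] together with the numbers [- x_r^i] for
    [1 <= i <= r], with the announced exponents.  It remains to see that these
    numbers are distinct, where [D_0] is also [- x_r^0]: the sign of [x_r^i] is
    given by the parity of [i], and within one parity the absolute values
    decrease because [a_i >= 2]. *)
Require Import Defs.
From HB Require Import structures.
From mathcomp Require Import all_boot all_order all_algebra.
From mathcomp Require Import reals.
From mathcomp Require Import perm zify ring.

Set Implicit Arguments.
Unset Strict Implicit.
Unset Printing Implicit Defensive.

Import Order.TTheory GRing.Theory Num.Theory.
Local Open Scope ring_scope.

(* Both sides are computed from the bordered matrix [[M, -1], [t, 1]], by
   eliminating either the bottom row or the right column. *)
Lemma det_add_const_mx (K : comPzRingType) n (M : 'M[K]_n) (s t : K) :
    (forall i, \sum_j M i j = s) ->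
  \det (M + const_mx t) * s = \det M * (s + t *+ n).
Proof.
move=> Ms; pose one : 'cV[K]_n := const_mx 1; pose tr : 'rV[K]_n := const_mx t.
pose B := block_mx M (- one) tr (1%:M : 'M_1).
have <- : \det B = \det (M + const_mx t).
  have <- : \det (B *m block_mx 1%:M 0 (- tr) (1%:M : 'M_1)) = \det B.
    by rewrite det_mulmx det_lblock !det1 !mulr1.
  rewrite mulmx_block !mulmx1 !mulmx0 !mul1mx !add0r subrr det_ublock det1 mulr1.
  congr (\det (_ + _)); apply/matrixP=> i j.
  by rewrite mulNmx mulmxN opprK !mxE big_ord1 !mxE mul1r.
have {1}-> : s = \det (block_mx 1%:M one 0 (s%:M : 'M_1)).
  by rewrite det_ublock det1 mul1r det_scalar1.
rewrite -det_mulmx mulmx_block !mulmx1 !mulmx0 !mul1mx !addr0.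
have -> : M *m one + - one *m s%:M = 0.
  apply/matrixP=> i j; rewrite !mxE big_ord1 !mxE ord1 eqxx mulr1n mulN1r.
  by apply/eqP; rewrite subr_eq0 -(Ms i); apply/eqP/eq_bigr=> k _;
    rewrite mxE mulr1.
rewrite det_lblock; congr (_ * _); rewrite det_mx11 !mxE eqxx mulr1n addrC.
congr (_ + _); rewrite (eq_bigr (fun=> t)) ?sumr_const ?card_ord // => j _.
by rewrite !mxE mulr1.
Qed.

(** Two enumerations differ by a permutation, applied to rows and columns alike, so its sign occurs
    twice and cancels. *)
Lemma det_reindex (K : comPzRingType) (T : finType) (f : T -> T -> K) m n
    (g : 'I_m -> T) (h : 'I_n -> T) : bijective g -> bijective h ->
  \det (\matrix_(i, j) f (g i) (g j)) = \det (\matrix_(i, j) f (h i) (h j)).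
Proof.
move=> bij_g bij_h.
have emn : m = n.
  by rewrite -[m]card_ord -[n]card_ord (bij_eq_card bij_g) (bij_eq_card bij_h).
case: n / emn h bij_h => h bij_h.
have [h' hK h'K] := bij_h.
have sI : injective (h' \o g) := inj_comp (can_inj h'K) (bij_inj bij_g).
pose s := perm sI.
have -> : \matrix_(i, j) f (g i) (g j) =
    row_perm s (col_perm s (\matrix_(i, j) f (h i) (h j))).
  by apply/matrixP=> i j; rewrite !mxE !permE /= !h'K.
rewrite row_permE col_permE !det_mulmx !det_perm odd_permV mulrC -mulrA.
by rewrite -signr_addb addbb mulr1.
Qed.

(** Indexing by a finite type lets leaves of a node be replaced by pairs (copy, leaf) without
    following their enumerations. *)
Definition fdet (K : comPzRingType) (T : finType) (f : T -> T -> K) : K :=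
  \det (\matrix_(i < #|T|, j < #|T|) f (enum_val i) (enum_val j)).

Lemma fdetE (K : comPzRingType) (T : finType) (f : T -> T -> K) n
    (g : 'I_n -> T) :
  bijective g -> fdet f = \det (\matrix_(i, j) f (g i) (g j)).
Proof. by move=> bij_g; apply: det_reindex => //; apply: enum_val_bij. Qed.

Lemma fdet_bij (K : comPzRingType) (T U : finType) (h : T -> U)
    (f : U -> U -> K) :
  bijective h -> fdet (fun x y => f (h x) (h y)) = fdet f.
Proof.
move=> bij_h; rewrite [RHS](@fdetE _ U f #|T| (h \o enum_val)) //.
exact: bij_comp bij_h (enum_val_bij _).
Qed.

Lemma eq_fdet (K : comPzRingType) (T : finType) (f g : T -> T -> K) :
  f =2 g -> fdet f = fdet g.
Proof. by move=> fg; congr (\det _); apply/matrixP=> i j; rewrite !mxE. Qed.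

Lemma fdet_add_const (K : comPzRingType) (T : finType) (f : T -> T -> K) s t :
    (forall x, \sum_y f x y = s) ->
  fdet (fun x y => f x y + t) * s = fdet f * (s + t *+ #|T|).
Proof.
move=> fs; rewrite -det_add_const_mx => [|i]; last first.
  rewrite -(fs (enum_val i)) [RHS](reindex_onto enum_val enum_rank) /=.
    by apply: eq_big => [j|j _]; rewrite ?enum_valK ?eqxx ?mxE.
  by move=> x _; rewrite enum_rankK.
by congr (\det _ * _); apply/matrixP=> i j; rewrite !mxE.
Qed.

Lemma fdet_copies (K : comPzRingType) (T : finType) (f : T -> T -> K) k :
  fdet (fun u v : 'I_k * T => if u.1 == v.1 then f u.2 v.2 else 0)
    = fdet f ^+ k.
Proof.
elim: k => [|k IHk].
  have card0 : #|{: 'I_0 * T}| = 0%N by rewrite card_prod card_ord.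
  by rewrite /fdet; move: (\matrix_(_, _) _); rewrite card0 => M; rewrite det_mx00.
(* This enumeration lists copy 0 first, so the matrix becomes block diagonal, with the remaining [k]
   copies in the second block. *)
pose h (i : 'I_(#|T| + #|{: 'I_k * T}|)) : 'I_k.+1 * T :=
  match split i with
  | inl x => (ord0, enum_val x)
  | inr u => (lift ord0 (enum_val u).1, (enum_val u).2)
  end.
have h_inj : injective h.
  move=> i j; rewrite /h -{2}[i]splitK -{2}[j]splitK.
  case: (split i) (split j) => [x|u] [y|v] //= [].
    by move/enum_val_inj->.
  move=> e1 e2; congr (rshift _ _); apply: enum_val_inj.
  by case: (enum_val u) (enum_val v) e1 e2 => [p q] [p' q'] /= /val_inj-> ->.
have bij_h : bijective h.
  by apply: inj_card_bij => //; rewrite card_ord !card_prod !card_ord mulSn.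
rewrite (fdetE _ bij_h) exprS -IHk -(det_ublock _ 0).
have hl x : h (lshift _ x) = (ord0, enum_val x).
  by rewrite /h -[lshift _ x]/(unsplit (inl x)) unsplitK.
have hr u : h (rshift _ u) = (lift ord0 (enum_val u).1, (enum_val u).2).
  by rewrite /h -[rshift _ u]/(unsplit (inr u)) unsplitK.
congr (\det _); apply/matrixP=> i j; rewrite mxE.
case: (split_ordP i) (split_ordP j) => [x|u] -> [y|v] ->; rewrite ?hl ?hr.
- by rewrite block_mxEul mxE.
- by rewrite block_mxEur mxE.
- by rewrite block_mxEdl mxE.
- by rewrite block_mxEdr mxE (inj_eq lift_inj).
Qed.

(** * Union or join of [k] copies of a regular cograph *)

Section Copies.
Variables (R : realType) (lab : colabel) (k : nat) (t : cotree) (D : R).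
Let n := #|leaves t|.
Let c : R := if lab is Join then 1 else 0.
Let t' := Node lab (fun _ : 'I_k => t).
Hypothesis regular : forall u : leaves t, \sum_v (cograph_adj u v)%:R = D.

Lemma cograph_adj_Node (u v : leaves t') :
  (cograph_adj u v)%:R =
    if tag u == tag v then (cograph_adj (tagged u) (tagged v))%:R else c :> R.
Proof.
case: u v => [i p] [j q]; rewrite /cograph_adj /=.
case: eqVneq => [eij|_]; last by rewrite /c; case: lab.
by move: p q; case: j / eij => p q; rewrite tagged_asE.
Qed.

Let copy_leaf (u : 'I_k * leaves t) : leaves t' :=
  existT (fun=> leaves t) u.1 u.2.

Lemma copy_leaf_bij : bijective copy_leaf.
Proof. by exists (fun u : leaves t' => (tag u, tagged u)) => -[]. Qed.

Lemma regular_Node (u : leaves t') :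
  \sum_v (cograph_adj u v)%:R = D + c * (n * k.-1)%:R.
Proof.
rewrite (reindex _ (onW_bij _ copy_leaf_bij)) /=.
under eq_bigr do rewrite cograph_adj_Node.
rewrite -(pair_bigA _ (fun i q => if tag u == i then
  (cograph_adj (tagged u) q)%:R else c)) /=.
rewrite (bigD1 (tag u)) //= eqxx regular; congr (_ + _).
rewrite (eq_bigr (fun=> c *+ n)) => [|i]; last first.
  by rewrite eq_sym => /negPf->; rewrite sumr_const.
rewrite sumr_const cardC1 card_ord -mulrnA mulr_natr //.
Qed.

Lemma char_poly_fdet (s : cotree) :
  char_poly (adjacency_mx R (@cograph_adj s)) =
    fdet (fun u v : leaves s => 'X *+ (u == v) - ((cograph_adj u v)%:R : R)%:P).
Proof.
congr (\det _); apply/matrixP=> i j.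
by rewrite !mxE (inj_eq enum_val_inj).
Qed.

Lemma char_poly_Node (Q : {poly R}) : (0 < k)%N ->
    char_poly (adjacency_mx R (@cograph_adj t)) = ('X - D%:P) * Q ->
  char_poly (adjacency_mx R (@cograph_adj t')) =
    ('X - (D + c * (n * k.-1)%:R)%:P) *
      (Q ^+ k * ('X - (D - c * n%:R)%:P) ^+ k.-1).
Proof.
move=> k_gt0; rewrite !char_poly_fdet => detQ.
set f := (fun u v : leaves t => _) in detQ.
have f_sum u : \sum_v f u v = 'X - D%:P.
  rewrite sumrB -(regular u) rmorph_sum; congr (_ - _).
  rewrite (bigD1 u) //= eqxx big1 ?addr0 // => v.
  by rewrite eq_sym => /negPf->.
pose g (u v : leaves t) := f u v + c%:P.
(* Outside the diagonal blocks the characteristic matrix is constantly [- c]; adding [c] everywhere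
   leaves [G], with a copy of [g] in each diagonal block. *)
pose G (u v : 'I_k * leaves t) := if u.1 == v.1 then g u.2 v.2 else 0.
set s := 'X - (D - _)%:P.
have s_def : s = 'X - D%:P + c%:P *+ n.
  by rewrite /s polyCB opprB mulr_natr polyCMn; ring.
have s0 d : 'X - d%:P != 0 :> {poly R} by rewrite polyXsubC_eq0.
have detg : fdet g = Q * s.
  (* The row-sum identity determines [fdet g] only up to the factor ['X - D%:P], which is nonzero
     and cancels. *)
  apply: (mulIf (s0 D)); rewrite (fdet_add_const _ f_sum) detQ -s_def.
  by rewrite -mulrA mulrC.
have G_sum u : \sum_v G u v = s.
  rewrite -(pair_bigA _ (fun i q => if u.1 == i then g u.2 q else 0)) /=.
  rewrite (bigD1 u.1) //= eqxx [X in _ + X]big1 => [|i]; last first.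
    by rewrite eq_sym => /negPf->; rewrite big1.
  by rewrite addr0 big_split /= f_sum sumr_const s_def.
rewrite -(fdet_bij _ copy_leaf_bij).
rewrite (@eq_fdet _ _ _ (fun u v => G u v - c%:P)) => [|[i p] [j q]]; last first.
  rewrite cograph_adj_Node /= /G /g /f /=.
  rewrite (inj_eq (bij_inj copy_leaf_bij)) xpair_eqE.
  by case: (i == j) => /=; rewrite ?addrK ?add0r ?mulr0n ?sub0r.
apply: (mulIf (s0 (D - c * n%:R))); rewrite -/s (fdet_add_const _ G_sum).
rewrite fdet_copies detg exprMn -{2}(prednK k_gt0) exprSr.
have -> : s + - c%:P *+ #|{: 'I_k * leaves t}| =
    'X - (D + c * (n * k.-1)%:R)%:P.
  rewrite s_def card_prod card_ord -{1}(prednK k_gt0) mulSn mulnC.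
  by rewrite mulr_natr polyCD polyCMn mulNrn mulrnDr; ring.
by rewrite [RHS]mulrC; ring.
Qed.
End Copies.

(** * Recurrences and bounds for the numbers [xval], then the spectrum *)

Section Spectrum.
Variables (a : nat -> nat) (r : nat).
Let N (i : nat) : int := gamma a r i.+1.

Lemma gammaS i : (i <= r)%N -> gamma a r i = (a i * gamma a r i.+1)%N.
Proof. by move=> ir; rewrite /gamma big_ltn. Qed.

(** Setting [j = i + k] merges the two parity cases: both signs equal [(-1) ^+ (i + k)]. *)
Lemma xvalE i : (i <= r)%N ->
  xval a r i = \sum_(i.+1 <= j < r.+1) (-1) ^+ j * (gamma a r j)%:Z + eps r.
Proof.
move=> ir; rewrite /xval -[i.+1]add1n big_addn subSn //.
case: ifP => odd_i; congr (_ + _); apply: eq_bigr => k _;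
  by rewrite mulrC addnC exprD -(signr_odd _ i) odd_i ?mulr1 ?exprSr.
Qed.

Lemma xval_last : xval a r r = eps r.
Proof. by rewrite xvalE // big_geq // add0r. Qed.

Lemma xvalS i : (i < r)%N -> xval a r i = xval a r i.+1 - (-1) ^+ i * N i.
Proof.
move=> ir; rewrite !xvalE //; last exact: ltnW.
by rewrite big_ltn // exprS mulN1r mulNr -addrA addrC.
Qed.

(* The common degree of the cographs below the nodes at level [i]. *)
Definition degree (i : nat) : int := - xval a r i + (odd i)%:R * N i.

Hypothesis ha : forall i, (1 <= i <= r)%N -> (2 <= a i)%N.

Lemma gamma_gt0 i : 0 < N i.
Proof.
rewrite ltz_nat /gamma big_nat prodn_cond_gt0 // => j /andP[ij jr].
by rewrite ltnW // ha // (leq_ltn_trans _ ij).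
Qed.

Lemma gamma_double i : (i < r)%N -> N i.+1 *+ 2 <= N i.
Proof.
move=> ir; rewrite /N [in leRHS]gammaS // -mulr_natl natz -PoszM lez_nat.
by rewrite leq_mul2r ha ?orbT.
Qed.

Lemma gamma_anti i j : (i <= j <= r)%N -> N j <= N i.
Proof.
case/andP=> ij; elim: j ij => [|j IHj]; first by rewrite leqn0 => /eqP->.
rewrite leq_eqVlt => /predU1P[->//|ij jr]; apply: le_trans (IHj ij (ltnW jr)).
by apply: le_trans (gamma_double jr); rewrite mulr2n lerDl ltW // gamma_gt0.
Qed.

(** Descending induction from [N r = 1]: in the recurrence [xvalS] the term [N i] fixes the sign, as
    it is at least twice [N i.+1], which bounds the next value. *)
Lemma xval_bound i : (i <= r)%N ->
  if odd i then 0 < xval a r i <= N i else - N i < xval a r i <= 0.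
Proof.
move=> ir; have [d] := ubnP (r - i).
elim: d i ir => // d IHd i ir lt_d.
have [->|lt_ir] := eqVneq i r.
  by rewrite xval_last /eps /N /gamma big_geq; case: odd.
have {}lt_ir : (i < r)%N by rewrite ltn_neqAle lt_ir.
have lt_d' : (r - i.+1 < d)%N by rewrite subnS -ltnS prednK ?subn_gt0.
have := IHd i.+1 lt_ir lt_d'; rewrite (xvalS lt_ir) -(signr_odd _ i) /=.
have := gamma_double lt_ir; have := gamma_gt0 i.+1.
by case: odd; rewrite ?expr0 ?expr1 /=; lia.
Qed.

(* [xval i] and [xval j] differ in sign, or else
   [|xval i| >= N i - N i.+1 >= N i.+1 >= N j >= |xval j|], where the first
   inequality is strict for odd [i] and the last one for even [j]. *)
Lemma xval_neq i j : (i < j <= r)%N -> xval a r i != xval a r j.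
Proof.
case/andP=> ij jr; have ir := leq_trans ij jr.
have := xval_bound (ltnW ir); have := xval_bound ir.
have := xval_bound jr; have := gamma_double ir; have := gamma_gt0 i.+1.
rewrite (xvalS ir) /= -(signr_odd _ i).
have := gamma_anti (_ : i.+1 <= j <= r)%N; rewrite ij jr => /(_ isT).
by case: (odd i); case: (odd j); rewrite /= ?expr0 ?expr1; lia.
Qed.

Lemma degree_last : degree r = 0.
Proof.
by rewrite /degree xval_last /eps /N /gamma big_geq //; case: odd.
Qed.

(** The right side is the new eigenvalue [D - c * n] of [char_poly_Node] for a node at level [i]. *)
Lemma xval_degree i :
  - xval a r i.+1 = degree i.+1 - (~~ odd i)%:R * N i.+1.
Proof. by rewrite /degree /= addrK. Qed.

Lemma degreeS i : (i < r)%N ->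
  degree i = degree i.+1 + (~~ odd i)%:R * (gamma a r i.+2 * (a i.+1).-1)%:Z.
Proof.
move=> ir; have a_gt0 : (0 < a i.+1)%N by rewrite ltnW // ha.
have Ni : N i = N i.+1 + (gamma a r i.+2 * (a i.+1).-1)%:Z.
  by rewrite /N [in LHS]gammaS // -{1}(prednK a_gt0) mulSn PoszD mulnC.
rewrite /degree (xvalS ir) -(signr_odd _ i) /= Ni.
by case: odd; rewrite /= ?expr0 ?expr1; ring.
Qed.

Variable R : realType.

Lemma balanced_spectrum d l : (l + d)%N = r ->
  (forall u : leaves (balanced_below a l d),
     \sum_v (cograph_adj u v)%:R = (degree l)%:~R :> R) /\
  char_poly (adjacency_mx R (@cograph_adj (balanced_below a l d))) =
    ('X - ((degree l)%:~R)%:P) *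
    \prod_(l.+1 <= j < r.+1) ('X - (- (xval a r j)%:~R)%:P)
      ^+ (\prod_(l.+1 <= i < j) a i * (a j).-1).
Proof.
elim: d l => [|d IHd] l.
  rewrite addn0 => ->; rewrite degree_last; split=> [[]|].
    by rewrite big_const card_unit /= addr0.
  rewrite big_geq // mulr1 polyC0 subr0 char_poly_fdet.
  rewrite (@fdetE _ _ _ 1 (fun=> tt)); first by rewrite det_mx11 mxE polyC0 subr0.
  by exists (fun=> ord0) => [i|[]]; rewrite ?(ord1 i).
move=> lr; have lt_lr : (l < r)%N by rewrite -lr addnS ltnS leq_addr.
have [reg cp] := IHd l.+1 (etrans (addSnnS _ _) lr).
have a_gt0 : (0 < a l.+1)%N by rewrite ltnW // ha.
have cardN : #|leaves (balanced_below a l.+1 d)| = gamma a r l.+2.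
  by rewrite card_balanced_below addSnnS lr.
have cE : (if level_label l is Join then 1 else 0) = (~~ odd l)%:R :> R.
  by rewrite /level_label; case: odd.
have degE : (degree l.+1)%:~R + (if level_label l is Join then 1 else 0) *
    (#|leaves (balanced_below a l.+1 d)| * (a l.+1).-1)%:R =
    (degree l)%:~R :> R.
  by rewrite (degreeS lt_lr) cardN cE [in RHS]intrD [in RHS]intrM mulrz_nat.
split=> [u|]; first by rewrite -degE; apply: regular_Node reg u.
rewrite (char_poly_Node (level_label l) reg a_gt0 cp) degE; congr (_ * _).
(* The index [l.+1] carries the eigenvalue created at this node; all later exponents are multiplied
   by [a l.+1]. *)
rewrite [RHS]big_ltn // (big_geq (leqnn l.+1)) mul1n mulrC; congr (_ * _).
  congr (('X - _%:P) ^+ _).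
  by rewrite cardN cE -[RHS]mulrNz xval_degree [RHS]intrB intrM mulrz_nat.
rewrite -prodrXl; apply: eq_big_nat => j /andP[lj _].
by rewrite -exprM [in RHS]big_ltn // mulnC mulnA.
Qed.
End Spectrum.

(** * Reading off multiplicities *)

Lemma mup_prod_XsubCX (F : fieldType) (I : Type) (s : seq I) (z : I -> F)
    (m : I -> nat) x :
  mup x (\prod_(i <- s) ('X - (z i)%:P) ^+ m i) =
    (\sum_(i <- s | z i == x) m i)%N.
Proof.
have nz i : ('X - (z i)%:P) ^+ m i != 0 by rewrite expf_neq0 ?polyXsubC_eq0.
elim: s => [|i s IHs]; first by rewrite !big_nil mupNroot ?root1.
rewrite !big_cons mupM // ?mup_XsubCX ?IHs; first by case: eqP.
by rewrite prodf_seq_neq0 (eq_all (a2 := predT)) ?all_predT.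
Qed.

Theorem theorem5 (R : realType) (r : nat) (a : nat -> nat)
    (hr : (2 <= r)%N) (ha : forall i : nat, (1 <= i <= r)%N -> (2 <= a i)%N) :
  let A := adjacency_mx R (@cograph_adj (balanced_cotree a r)) in
  forall i : nat, (1 <= i <= r - 1)%N ->
    eigenvalue A (- (xval a r i)%:~R) /\
    eigen_mult (- (xval a r i)%:~R) A
      = ((\prod_(1 <= j < i) a j) * (a i - 1))%N.
Proof.
move=> A i /andP[i_gt0 ir1].
have ir : (i <= r)%N by rewrite (leq_trans ir1) // leq_subr.
have [_] := @balanced_spectrum a r ha R r 0 (add0n r).
rewrite -/(balanced_cotree a r) -/A /degree mul0r addr0 rmorphN => cpE.
have multE : eigen_mult (- (xval a r i)%:~R) A =
    ((\prod_(1 <= j < i) a j) * (a i - 1))%N.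
  (* The degree factor has root [- xval a r 0], which differs from the eigenvalue considered. *)
  rewrite /eigen_mult cpE mupMr; last first.
    by rewrite root_XsubC eqr_opp eqr_int eq_sym xval_neq // i_gt0.
  (* Since the values [xval] are distinct, only [j = i] contributes to the sum. *)
  rewrite mup_prod_XsubCX big_mkcond /= (bigD1_seq i) ?iota_uniq //=; last first.
    by rewrite mem_index_iota i_gt0.
  rewrite eqxx subn1 [X in (_ + X)%N]big1_seq ?addn0 // => j /andP[ji].
  rewrite mem_index_iota eqr_opp eqr_int => /andP[_ jr].
  suff /negPf-> : xval a r j != xval a r i by [].
  move: ji; rewrite neq_ltn => /orP[] ij; last rewrite eq_sym.
    by rewrite xval_neq // ij.
  by rewrite xval_neq // ij.
(* Being an eigenvalue amounts to positive multiplicity, which follows from [2 <= a i]. *)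
split=> //; rewrite eigenvalue_root_char -dvdp_XsubCl.
rewrite XsubC_dvd ?monic_neq0 ?char_poly_monic //.
rewrite -/(eigen_mult _ A) multE muln_gt0 subn_gt0 ha ?i_gt0 // andbT.
rewrite big_nat prodn_cond_gt0 // => j /andP[j_gt0 ji].
by rewrite ltnW // ha // j_gt0 (leq_trans (ltnW ji)).
Qed.
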